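(* Let $S=\mathbb{C}^{\oplus n}$ with standard orthogonal idempotents $e_1,\dots,e_n$, and for $i\neq j$ let $y^{ij}$ be the double derivation $y^{ij}(s)=e_i\otimes e_js-se_i\otimes e_j$ of $S$. Let $P=\sum_{i<j}\alpha_{ij}\,y^{ij}y^{ji}\in\mathbb{D}S=T_S\mathrm{Der}(S,S\otimes S)$ with $\alpha_{ij}\in\mathbb{C}$. Then $P$ determines a double Poisson bracket on $S$ (i.e. $\{\!\!\{-,-\}\!\!\}_P$ is a double Poisson bracket) if and only if $$\forall\, i<j<k:\quad \alpha_{ij}\alpha_{ik}+\alpha_{ik}\alpha_{jk}-\alpha_{ij}\alpha_{jk}=0.$$
   Context: $\mathbb{C}$ is an algebraically closed field of characteristic $0$, $\otimes=\otimes_{\mathbb{C}}$. $\mathrm{Der}(S,S\otimes S)$ is the set of double derivations, i.e. derivations $S\to S\otimes S$ for the outer bimodule structure $a\cdot(a'\otimes a'')\cdot b=aa'\otimes a''b$; it is an $S$-bimodule by $(s\vartheta t)(u)=\vartheta(u)'t\otimes s\vartheta(u)''$ (Sweedler notation). $T_S$ denotes the tensor algebra over $S$. A degree $2$ element $\delta\Delta$ of $\mathbb{D}S$ gives the map $\{\!\!\{a,b\}\!\!\}_{\delta\Delta}=\Delta(b)'\delta(a)''\otimes\delta(a)'\Delta(b)''-\delta(b)'\Delta(a)''\otimes\Delta(a)'\delta(b)''$, extended linearly to all degree $2$ elements $P$. A double Poisson bracket on an algebra $A$ is a linear map $\{\!\!\{-,-\}\!\!\}:A\otimes A\to A\otimes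 A$ that is a derivation in its second argument for the outer bimodule structure, satisfies $\{\!\!\{a,b\}\!\!\}=-\{\!\!\{b,a\}\!\!\}^{o}$ (where $(x\otimes y)^o=y\otimes x$), and satisfies the double Jacobi identity: writing $\{\!\!\{a,\,x\otimes y\}\!\!\}_L=\{\!\!\{a,x\}\!\!\}\otimes y$ and $\tau(x\otimes y\otimes z)=z\otimes x\otimes y$, one has $\{\!\!\{a,\{\!\!\{b,c\}\!\!\}\}\!\!\}_L+\tau\{\!\!\{b,\{\!\!\{c,a\}\!\!\}\}\!\!\}_L+\tau^2\{\!\!\{c,\{\!\!\{a,b\}\!\!\}\}\!\!\}_L=0$ for all $a,b,c\in A$. *)

(* Defs.v *)
From HB Require Import structures.
From mathcomp Require Import all_boot all_algebra.
From mathcomp Require Import generic_quotient ring_quotient.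
From mathcomp Require Import boolp functions.
From mathcomp Require Import finmap monalg.

Set Implicit Arguments.
Unset Strict Implicit.
Unset Printing Implicit Defensive.

Import GRing.Theory.
Local Open Scope ring_scope.
Local Open Scope quotient_scope.

Reserved Notation "x ⊗ y" (at level 40, left associativity).

Section ModuleQuotient.
Variables (K : fieldType) (V : lmodType K) (X : V -> Prop).

Inductive span : V -> Prop :=
| Span0 : span 0
| SpanS c x v : X x -> span v -> span (c *: x + v).

Lemma span_gen x : X x -> span x.
Proof. by move=> Xx; rewrite -[x]addr0 -[x]scale1r; apply: SpanS Xx Span0. Qed.

Lemma spanD u v : span u -> span v -> span (u + v).
Proof.
elim=> [|c x w Xx _ IH] hv; first by rewrite add0r.
by rewrite -addrA; apply: SpanS Xx (IH hv).
Qed.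

Lemma spanZ c v : span v -> span (c *: v).
Proof.
elim=> [|d x w Xx _ IH]; first by rewrite scaler0; apply: Span0.
by rewrite scalerDr scalerA; apply: SpanS Xx IH.
Qed.

Definition span_pred : {pred V} := fun v => `[< span v >].

Lemma span_predP v : reflect (span v) (v \in span_pred).
Proof. exact: asboolP. Qed.

Lemma span_zmod_closed : zmod_closed span_pred.
Proof.
split; first by apply/span_predP/Span0.
move=> u v /span_predP hu /span_predP hv; apply/span_predP.
by rewrite -scaleN1r; apply: spanD hu (spanZ _ hv).
Qed.

HB.instance Definition _ := GRing.isZmodClosed.Build V span_pred span_zmod_closed.

Definition modquot : Type := Quotient.quot span_pred.
HB.instance Definition _ := EqQuotient.on modquot.
HB.instance Definition _ := Choice.on modquot.
HB.instance Definition _ := GRing.Zmodule.on modquot.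

Definition mqpi (v : V) : modquot := \pi_modquot v.

Lemma mqpiK (q : modquot) : mqpi (repr q) = q.
Proof. exact: reprK. Qed.

Lemma mqpiB : {morph mqpi : u v / u - v}.
Proof. by move=> u v; rewrite /mqpi !piE. Qed.

Lemma mqpi_eq u v : (mqpi u = mqpi v) <-> span (u - v).
Proof.
have E := Quotient.idealrBE span_pred u v.
split=> [h|/span_predP]; last by rewrite E => /eqP.
by apply/span_predP; rewrite E; apply/eqP.
Qed.


Definition mqscale (c : K) (q : modquot) : modquot := mqpi (c *: repr q).

Lemma mqpiZ c v : mqpi (c *: v) = mqscale c (mqpi v).
Proof.
apply/mqpi_eq; rewrite -scalerBr; apply: spanZ.
by apply/mqpi_eq; rewrite mqpiK.
Qed.

Lemma mqpiD : {morph mqpi : u v / u + v}.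
Proof. by move=> u v; rewrite /mqpi !piE. Qed.

Fact mqscaleA c d q : mqscale c (mqscale d q) = mqscale (c * d) q.
Proof. by rewrite -(mqpiK q) -!mqpiZ scalerA. Qed.
Fact mqscale1 : left_id 1 mqscale.
Proof. by move=> q; rewrite -(mqpiK q) -mqpiZ scale1r. Qed.
Fact mqscaleDr : right_distributive mqscale +%R.
Proof.
by move=> c p q; rewrite -(mqpiK p) -(mqpiK q) -mqpiD -!mqpiZ -mqpiD scalerDr.
Qed.
Fact mqscaleDl q : {morph mqscale^~ q : c d / c + d}.
Proof. by move=> c d /=; rewrite -(mqpiK q) -!mqpiZ -mqpiD scalerDl. Qed.

HB.instance Definition _ := GRing.Zmodule_isLmodule.Build K modquot
  mqscaleA mqscale1 mqscaleDr mqscaleDl.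

Lemma mqpi_linear : linear mqpi.
Proof. by move=> c u v; rewrite mqpiD mqpiZ. Qed.

Definition mqlift (U : Type) (f : V -> U) (q : modquot) : U := f (repr q).

Section Lift.
Variables (U : lmodType K) (f : V -> U).
Hypotheses (f_lin : linear f) (fX : forall x, X x -> f x = 0).

Lemma mqliftE v : mqlift f (mqpi v) = f v.
Proof.
have f0 : f 0 = 0 by have := f_lin (-1) 0 0; rewrite scaler0 addr0 scaleN1r addNr.
have fs w : span w -> f w = 0.
  by elim=> [//|c x w' Xx _ IH]; rewrite f_lin fX // IH scaler0 addr0.
have /fs : span (repr (mqpi v) - v) by apply/mqpi_eq; rewrite mqpiK.
by rewrite addrC -scaleN1r f_lin scaleN1r addrC => /eqP; rewrite subr_eq0 => /eqP.
Qed.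

Lemma mqlift_linear : linear (mqlift f).
Proof.
move=> c p q; rewrite -[in LHS](mqpiK p) -[in LHS](mqpiK q) -mqpi_linear.
by rewrite mqliftE f_lin.
Qed.
End Lift.

End ModuleQuotient.

Section TensorProduct.
Variables (K : fieldType) (V W : lmodType K).

(* The generators of the submodule defining V ⊗ W as a quotient of the free
   K-module on V * W. *)
Inductive bilin_rel : {malg K[(V * W)%type]} -> Prop :=
| BilinL c x x' y :
    bilin_rel (<< (c *: x + x', y) >> - (c *: << (x, y) >> + << (x', y) >>))
| BilinR c x y y' :
    bilin_rel (<< (x, c *: y + y') >> - (c *: << (x, y) >> + << (x, y') >>)).

Definition tensor : Type := modquot bilin_rel.
HB.instance Definition _ := GRing.Lmodule.on tensor.

End TensorProduct.

HB.lock Definition tens (K : fieldType) (V W : lmodType K) (x : V) (y : W) :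
  tensor V W := mqpi (@bilin_rel K V W) << (x, y) >>.

(* Sweedler notation: [swd f t] is f(t', t''), the sum of k *: f v w over a
   chosen expression of t as a sum of k *: (v ⊗ w).  When f is bilinear it does
   not depend on the expression, see [swdE] and [swd_linear]. *)
HB.lock Definition swd (K : fieldType) (V W U : lmodType K) (f : V -> W -> U)
    (t : tensor V W) : U :=
  mqlift (fun g : {malg K[(V * W)%type]} =>
            \sum_(p <- msupp g) mcoeff p g *: f p.1 p.2) t.

Section TensorTheory.
Variables (K : fieldType) (V W : lmodType K).
Local Notation tens := (@tens K V W).

Definition bilin (U : lmodType K) (f : V -> W -> U) :=
  (forall y, linear (f^~ y)) /\ (forall x, linear (f x)).

Lemma tens_bilin : bilin tens.
Proof.
rewrite tens.unlock; split=> [y c x x'|x c y y'].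
  apply: etrans (mqpi_linear (@bilin_rel K V W) c << (x, y) >> << (x', y) >>).
  by apply/mqpi_eq/span_gen/BilinL.
apply: etrans (mqpi_linear (@bilin_rel K V W) c << (x, y) >> << (x, y') >>).
by apply/mqpi_eq/span_gen/BilinR.
Qed.

Section Sweedler.
Variables (U : lmodType K) (f : V -> W -> U).
Hypothesis f_bilin : bilin f.

Let F (g : {malg K[(V * W)%type]}) := \sum_(p <- msupp g) mcoeff p g *: f p.1 p.2.

Let Fw (D : {fset (V * W)}) g : (msupp g `<=` D)%fset ->
  F g = \sum_(p <- D) mcoeff p g *: f p.1 p.2.
Proof.
move=> /fsubsetP gD; rewrite /F; apply: big_fset_incl; first exact/fsubsetP.
by move=> p _ /mcoeff_outdom ->; rewrite scale0r.
Qed.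

Let F_linear : linear F.
Proof.
move=> c g h.
set D := (msupp g `|` msupp h `|` msupp (c *: g + h))%fset.
rewrite !(@Fw D); try by apply/fsubsetP=> p hp; rewrite !inE hp ?orbT.
rewrite scaler_sumr -big_split; apply: eq_bigr => p _ /=.
by rewrite mcoeffD mcoeffZ scalerDl scalerA.
Qed.

Let FU p : F << p >> = f p.1 p.2.
Proof.
rewrite (@Fw [fset p]%fset) ?big_seq_fset1 ?mcoeffUU ?scale1r //.
by apply/fsubsetP=> q; rewrite in_fset1; apply: contraTT => qp;
  rewrite -mcoeff_eq0 mcoeffU [p == q]eq_sym (negbTE qp).
Qed.

Let F_rel g : bilin_rel g -> F g = 0.
Proof.
have FB u v : F (u - v) = F u - F v.
  by rewrite -[- v]scaleN1r [u + _]addrC F_linear scaleN1r addrC.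
by case=> [c x x' y|c x y y']; rewrite FB F_linear !FU /=
  ?(f_bilin.1 y) ?(f_bilin.2 x) subrr.
Qed.

Lemma swdE x y : swd f (tens x y) = f x y.
Proof. rewrite swd.unlock tens.unlock; exact: etrans (mqliftE F_linear F_rel _) (FU _). Qed.

Lemma swd_linear : linear (swd f).
Proof. rewrite swd.unlock; exact: mqlift_linear F_linear F_rel. Qed.

End Sweedler.

Lemma linear0_ (U U' : lmodType K) (f : U -> U') : linear f -> f 0 = 0.
Proof. by move=> fl; have := fl (-1) 0 0; rewrite scaler0 addr0 scaleN1r addNr. Qed.

Lemma tensor_ext (U : lmodType K) (f g : tensor V W -> U) : linear f -> linear g ->
  (forall x y, f (tens x y) = g (tens x y)) -> f =1 g.
Proof.
move=> fl gl fg t; rewrite -(mqpiK t) [repr t]monalgE.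
elim/big_rec: _ => [|p u _ IH].
  by rewrite (linear0_ (mqpi_linear (@bilin_rel K V W))) !linear0_.
have -> : << mcoeff p (repr t) *g p >> = mcoeff p (repr t) *: << p >> :> {malg K[(V * W)%type]}.
  by apply/malgP=> q; rewrite mcoeffZ !mcoeffU mulr_natr.
case: p => x y; rewrite (mqpi_linear (@bilin_rel K V W)).
have E := fg x y; rewrite tens.unlock in E.
by rewrite (fl _ (mqpi _ _)) (gl _ (mqpi _ _)) IH E.
Qed.

End TensorTheory.

Section SweedlerParam.
Variable K : fieldType.
Implicit Types U V W : lmodType K.

Lemma linear_swd_param U V W (X : lmodType K) (F : U -> V -> W -> X) t :
  (forall x y, linear (fun u => F u x y)) -> linear (fun u => swd (F u) t).
Proof.
move=> Fl c u v; rewrite swd.unlock /mqlift scaler_sumr -big_split.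
by apply: eq_bigr => p _ /=; rewrite Fl scalerDr !scalerA mulrC.
Qed.

End SweedlerParam.

Notation "x ⊗ y" := (tens x y) : ring_scope.

Section BalancedTensorProduct.
Variables (K : fieldType) (A : Type) (M N : lmodType K).
Variables (ra : M -> A -> M) (la : A -> N -> N).

Inductive bal_rel : tensor M N -> Prop :=
| Bal m a n : bal_rel (ra m a ⊗ n - m ⊗ la a n).

Definition tensor_over : Type := modquot bal_rel.
HB.instance Definition _ := GRing.Lmodule.on tensor_over.

End BalancedTensorProduct.

HB.lock Definition tens_over (K : fieldType) (A : Type) (M N : lmodType K)
    (ra : M -> A -> M) (la : A -> N -> N) (m : M) (n : N) : tensor_over ra la :=
  mqpi (bal_rel ra la) (m ⊗ n).

HB.lock Definition swd_over (K : fieldType) (A : Type) (M N U : lmodType K)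
    (ra : M -> A -> M) (la : A -> N -> N) (f : M -> N -> U)
    (t : tensor_over ra la) : U := mqlift (swd f) t.

Section BalancedTheory.
Variables (K : fieldType) (A : Type) (M N : lmodType K).
Variables (ra : M -> A -> M) (la : A -> N -> N).
Local Notation tens_over := (@tens_over K A M N ra la).
Local Notation bal_rel := (bal_rel ra la).

Section Sweedler.
Variables (U : lmodType K) (f : M -> N -> U).
Hypotheses (f_bilin : bilin f) (f_bal : forall m a n, f (ra m a) n = f m (la a n)).

Let f_rel t : bal_rel t -> swd f t = 0.
Proof.
case=> m a n; rewrite -scaleN1r addrC (swd_linear f_bilin) scaleN1r.
by rewrite !(swdE f_bilin) f_bal addNr.
Qed.

Lemma swd_overE m n : swd_over f (tens_over m n) = f m n.
Proof. rewrite swd_over.unlock tens_over.unlock; exact: etrans (mqliftE (swd_linear f_bilin) f_rel _) (swdE f_bilin m n). Qed.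

Lemma swd_over_linear : linear (@swd_over K A M N U ra la f).
Proof. rewrite swd_over.unlock; exact: mqlift_linear (swd_linear f_bilin) f_rel. Qed.

End Sweedler.
End BalancedTheory.

Section LinearAux.
Variable K : fieldType.
Implicit Types U V W : lmodType K.

Lemma linear_comp_ U V W (f : V -> W) (g : U -> V) :
  linear f -> linear g -> linear (fun u => f (g u)).
Proof. by move=> fl gl c u v; rewrite gl fl. Qed.

Lemma linear_add_ U V (f g : U -> V) :
  linear f -> linear g -> linear (fun u => f u + g u).
Proof. by move=> fl gl c u v; rewrite fl gl scalerDr addrACA. Qed.

Lemma linear_opp_ U V (f : U -> V) : linear f -> linear (fun u => - f u).
Proof. by move=> fl c u v; rewrite fl opprD scalerN. Qed.

Lemma linear_scale U (c : K) : linear (fun u : U => c *: u).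
Proof. by move=> d u v; rewrite scalerDr !scalerA mulrC. Qed.

Lemma linear_mull (A : algType K) (a : A) : linear (fun x : A => a * x).
Proof. by move=> c x y; rewrite mulrDr scalerAr. Qed.

Lemma linear_mulr (A : algType K) (a : A) : linear (fun x : A => x * a).
Proof. by move=> c x y; rewrite mulrDl scalerAl. Qed.

Lemma bilin_tens (V W V' W' : lmodType K) (f : V -> V') (g : W -> W') :
  linear f -> linear g -> bilin (fun x y => f x ⊗ g y).
Proof.
move=> fl gl; split=> [y|x].
  exact: linear_comp_ ((tens_bilin V' W').1 (g y)) fl.
exact: linear_comp_ ((tens_bilin V' W').2 (f x)) gl.
Qed.

End LinearAux.

Section DoubleDerivations.
Variables (K : fieldType) (A : algType K).
Local Notation AA := (tensor A A).

(* The outer bimodule structure a . (x ⊗ y) . b = ax ⊗ yb. *)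
Definition outer (a : A) (t : AA) (b : A) : AA :=
  swd (fun x y => (a * x) ⊗ (y * b)) t.

(* The inner bimodule structure, x ⊗ y |-> xb ⊗ ay. *)
Definition inner (a : A) (t : AA) (b : A) : AA :=
  swd (fun x y => (x * b) ⊗ (a * y)) t.

Lemma outer_bilin a b : bilin (fun x y : A => (a * x) ⊗ (y * b)).
Proof. exact: bilin_tens (linear_mull a) (linear_mulr b). Qed.

Lemma inner_bilin a b : bilin (fun x y : A => (x * b) ⊗ (a * y)).
Proof. exact: bilin_tens (linear_mulr b) (linear_mull a). Qed.

Lemma outer_linear a b : linear (fun t => outer a t b).
Proof. exact: swd_linear (outer_bilin a b). Qed.

Lemma inner_linear a b : linear (fun t => inner a t b).
Proof. exact: swd_linear (inner_bilin a b). Qed.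

Lemma outerE a b x y : outer a (x ⊗ y) b = (a * x) ⊗ (y * b).
Proof. exact: swdE (outer_bilin a b) x y. Qed.

Lemma innerE a b x y : inner a (x ⊗ y) b = (x * b) ⊗ (a * y).
Proof. exact: swdE (inner_bilin a b) x y. Qed.

Lemma outer_inner a b c d t : inner a (outer c t d) b = outer c (inner a t b) d.
Proof.
apply: (tensor_ext (f := fun t => inner a (outer c t d) b)
                   (g := fun t => outer c (inner a t b) d)) => [||x y].
- exact: linear_comp_ (inner_linear a b) (outer_linear c d).
- exact: linear_comp_ (outer_linear c d) (inner_linear a b).
- by rewrite !(innerE, outerE) !mulrA.
Qed.

Definition is_dder (d : A -> AA) : Prop :=
  linear d /\ forall a b, d (a * b) = outer a (d b) 1 + outer 1 (d a) b.

Definition dder_pred : {pred A -> AA} := fun d => `[< is_dder d >].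

Lemma dder_submod_closed : submod_closed dder_pred.
Proof.
split=> [|c d d']; first (apply/asboolP; split=> [k u v|a b] /=).
- by rewrite scaler0 addr0.
- by rewrite !(linear0_ (outer_linear _ _)) addr0.
move=> /asboolP[dl dM] /asboolP[dl' dM']; apply/asboolP.
split=> [|a b]; first exact: linear_add_ (linear_comp_ (linear_scale c) dl) dl'.
rewrite [LHS](_ : _ = c *: d (a * b) + d' (a * b)) //.
rewrite [RHS](_ : _ = outer a (c *: d b + d' b) 1 + outer 1 (c *: d a + d' a) b) //.
by rewrite dM dM' !outer_linear scalerDr addrACA.
Qed.

HB.instance Definition _ :=
  GRing.isSubmodClosed.Build K (A -> AA) dder_pred dder_submod_closed.

Record dder := DDer { dder_fun :> A -> AA; dder_funP : dder_fun \in dder_pred }.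

HB.instance Definition _ := [isSub for dder_fun].
HB.instance Definition _ := [Choice of dder by <:].
HB.instance Definition _ := [SubChoice_isSubLmodule of dder by <:].

Lemma dderP (d : dder) : is_dder d.
Proof. exact/asboolP/(dder_funP d). Qed.

(* The A-bimodule Der(A, A ⊗ A): (s d t)(u) = d(u)' t ⊗ s d(u)''. *)
Fact dder_bimod_subproof (s : A) (d : dder) (t : A) :
  (fun u => inner s (d u) t) \in dder_pred.
Proof.
have [dl dM] := dderP d; apply/asboolP; split.
  exact: linear_comp_ (inner_linear s t) dl.
move=> a b; rewrite dM.
have := inner_linear s t 1 (outer a (d b) 1) (outer 1 (d a) b).
rewrite scale1r => ->; rewrite scale1r.
by congr (_ + _); apply: outer_inner.
Qed.

Definition dder_bimod (s : A) (d : dder) (t : A) : dder :=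
  DDer (dder_bimod_subproof s d t).

Fact commutator_dder (x y : A) :
  (fun s => x ⊗ (y * s) - (s * x) ⊗ y) \in dder_pred.
Proof.
have outerB a b u v : outer a (u - v) b = outer a u b - outer a v b.
  by rewrite -[- v]scaleN1r [u + _]addrC outer_linear scaleN1r addrC.
apply/asboolP; split=> [|a b].
  apply: linear_add_; last apply: linear_opp_.
    exact: linear_comp_ ((tens_bilin A A).2 x) (linear_mull y).
  exact: (linear_comp_ ((tens_bilin A A).1 y) (linear_mulr x)).
by rewrite !outerB !outerE !mul1r !mulr1 !mulrA [RHS]addrC addrA subrK.
Qed.

(* The degree 2 component Der(A, A ⊗ A) ⊗_A Der(A, A ⊗ A) of the tensor algebra
   T_A Der(A, A ⊗ A). *)
Definition DA2 : Type :=
  tensor_over (fun (d : dder) (a : A) => dder_bimod 1 d a)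
              (fun (a : A) (d : dder) => dder_bimod a d 1).
HB.instance Definition _ := GRing.Lmodule.on DA2.

(* The product of two degree 1 elements of T_A Der(A, A ⊗ A). *)
Definition dder_mul (d D : dder) : DA2 := tens_over _ _ d D.

(* D(b)'d(a)'' ⊗ d(a)'D(b)'' - d(b)'D(a)'' ⊗ D(a)'d(b)'', with d1, d2 (resp. D1,
   D2) the Sweedler components of the values of d (resp. D). *)
Definition mul_bracket (d D : dder) (a b : A) : AA :=
  swd (fun d1 d2 => swd (fun D1 D2 => (D1 * d2) ⊗ (d1 * D2)) (D b)) (d a)
  - swd (fun d1 d2 => swd (fun D1 D2 => (d1 * D2) ⊗ (D1 * d2)) (D a)) (d b).

(* The extension of [mul_bracket] to all degree 2 elements, see [bracketE] and
   [bracket_linear]. *)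
Definition bracket (P : DA2) : AA -> AA :=
  swd (fun a b => swd_over (fun d D => mul_bracket d D a b) P).

Let swd2 x y : bilin (fun D1 D2 : A => (D1 * y) ⊗ (x * D2)).
Proof. exact: bilin_tens (linear_mulr y) (linear_mull x). Qed.

Let swd2o x y : bilin (fun D1 D2 : A => (x * D2) ⊗ (D1 * y)).
Proof.
split=> z; first exact: linear_comp_ ((tens_bilin _ _).2 _) (linear_mulr y).
exact: (linear_comp_ ((tens_bilin _ _).1 (z * y)) (linear_mull x)).
Qed.

Let swd1 t : bilin (fun x y : A => swd (fun D1 D2 => (D1 * y) ⊗ (x * D2)) t).
Proof.
split=> z; apply: linear_swd_param => D1 D2.
  exact: linear_comp_ ((tens_bilin _ _).2 _) (linear_mulr D2).
exact: (linear_comp_ ((tens_bilin _ _).1 (z * D2)) (linear_mull D1)).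
Qed.

Let swd1o t : bilin (fun x y : A => swd (fun D1 D2 => (x * D2) ⊗ (D1 * y)) t).
Proof.
split=> z; apply: linear_swd_param => D1 D2.
  exact: (linear_comp_ ((tens_bilin _ _).1 (D1 * z)) (linear_mulr D2)).
exact: linear_comp_ ((tens_bilin _ _).2 _) (linear_mull D1).
Qed.

Lemma dder_eval_linear a : linear (fun d : dder => d a).
Proof. by move=> c d D. Qed.

Lemma mul_bracket_linear_ab (d D : dder) : bilin (mul_bracket d D).
Proof.
have [dl _] := dderP d; have [Dl _] := dderP D.
split=> z; apply: linear_add_; try apply: linear_opp_.
- exact: linear_comp_ (swd_linear (swd1 _)) dl.
- apply: linear_swd_param => x y; exact: linear_comp_ (swd_linear (swd2o x y)) Dl.
- apply: linear_swd_param => x y; exact: linear_comp_ (swd_linear (swd2 x y)) Dl.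
- exact: linear_comp_ (swd_linear (swd1o _)) dl.
Qed.

Lemma mul_bracket_bilin a b : bilin (fun d D => mul_bracket d D a b).
Proof.
split=> z; apply: linear_add_; try apply: linear_opp_.
- exact: linear_comp_ (swd_linear (swd1 _)) (dder_eval_linear a).
- exact: linear_comp_ (swd_linear (swd1o _)) (dder_eval_linear b).
- apply: linear_swd_param => x y.
  exact: linear_comp_ (swd_linear (swd2 x y)) (dder_eval_linear b).
- apply: linear_swd_param => x y.
  exact: linear_comp_ (swd_linear (swd2o x y)) (dder_eval_linear a).
Qed.

Let swd_inner (F : A -> A -> AA) s u t : bilin F ->
  swd F (inner s u t) = swd (fun x y => F (x * t) (s * y)) u.
Proof.
move=> Fb; have Gb : bilin (fun x y => F (x * t) (s * y)).
  split=> z; first exact: linear_comp_ (Fb.1 _) (linear_mulr t).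
  exact: linear_comp_ (Fb.2 _) (linear_mull s).
apply: (tensor_ext (f := fun u => swd F (inner s u t))
                   (g := fun u => swd _ u)) => [||x y].
- exact: linear_comp_ (swd_linear Fb) (inner_linear s t).
- exact: swd_linear Gb.
- by rewrite innerE !swdE.
Qed.

Lemma mul_bracket_balanced (d D : dder) s a b :
  mul_bracket (dder_bimod 1 d s) D a b = mul_bracket d (dder_bimod s D 1) a b.
Proof.
rewrite /mul_bracket /=; congr (_ - _); rewrite swd_inner //; congr swd;
  apply/funext => x; apply/funext => y; rewrite swd_inner //; congr swd;
  apply/funext => z; apply/funext => w.
all: by rewrite !mul1r !mulr1 !mulrA.
Qed.

Lemma bracketE d D a b : bracket (dder_mul d D) (a ⊗ b) = mul_bracket d D a b.
Proof.
have B : bilin (fun a b => swd_over (fun d D => mul_bracket d D a b) (dder_mul d D)).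
  have E a' b' := swd_overE (mul_bracket_bilin a' b')
    (fun d s D => mul_bracket_balanced d D s a' b') d D.
  split=> z c x y; rewrite !E.
    exact: (mul_bracket_linear_ab d D).1.
  exact: (mul_bracket_linear_ab d D).2.
rewrite /bracket (swdE B).
exact: swd_overE (mul_bracket_bilin a b)
  (fun d s D => mul_bracket_balanced d D s a b) d D.
Qed.

Lemma bracket_linear u : linear (fun P => bracket P u).
Proof.
apply: linear_swd_param => a b.
exact: swd_over_linear (mul_bracket_bilin a b)
  (fun d s D => mul_bracket_balanced d D s a b).
Qed.

End DoubleDerivations.

Section DoublePoisson.
Variables (K : fieldType) (A : algType K).
Local Notation AA := (tensor A A).
Local Notation AAA := (tensor AA A).

Definition swap (t : AA) : AA := swd (fun x y => y ⊗ x) t.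

(* x ⊗ y ⊗ z |-> z ⊗ x ⊗ y *)
Definition rot (t : AAA) : AAA :=
  swd (fun xy z => swd (fun x y => z ⊗ x ⊗ y) xy) t.

(* {{a, x ⊗ y}}_L = {{a, x}} ⊗ y *)
Definition bracketL (br : AA -> AA) (a : A) (t : AA) : AAA :=
  swd (fun x y => br (a ⊗ x) ⊗ y) t.

(* A double bracket {{a, b}} is encoded as the value at a ⊗ b of a map br on
   A ⊗ A. *)
Record double_poisson (br : AA -> AA) : Prop := {
  dp_linear : linear br;
  dp_derivation : forall a b c,
    br (a ⊗ (b * c)) = outer b (br (a ⊗ c)) 1 + outer 1 (br (a ⊗ b)) c;
  dp_antisym : forall a b, br (a ⊗ b) = - swap (br (b ⊗ a));
  dp_jacobi : forall a b c,
    bracketL br a (br (b ⊗ c)) + rot (bracketL br b (br (c ⊗ a)))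
      + rot (rot (bracketL br c (br (a ⊗ b)))) = 0
}.

End DoublePoisson.

Section DirectSum.
Variables (K : fieldType) (n : nat).

(* The algebra K^{n+1} with componentwise operations: an algType is nonzero, so
   at least one summand is required. *)
Definition dsum : Type := {ffun 'I_n.+1 -> K}.

HB.instance Definition _ := GRing.PzRing.copy dsum {ffun 'I_n.+1 -> K}.
HB.instance Definition _ := GRing.Lmodule.copy dsum {ffun 'I_n.+1 -> K^o}.

Fact dsum_oner_neq0 : 1 != 0 :> dsum.
Proof. exact: ffun1_nonzero ord0. Qed.

HB.instance Definition _ := GRing.PzSemiRing_isNonZero.Build dsum dsum_oner_neq0.

Fact dsum_scaleAl (c : K) (u v : dsum) : c *: (u * v) = (c *: u) * v.
Proof. by apply/ffunP=> i; rewrite !ffunE; apply: mulrA. Qed.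

HB.instance Definition _ := GRing.Lmodule_isLalgebra.Build K dsum dsum_scaleAl.

Fact dsum_scaleAr (c : K) (u v : dsum) : c *: (u * v) = u * (c *: v).
Proof. by apply/ffunP=> i; rewrite !ffunE; apply: mulrCA. Qed.

HB.instance Definition _ := GRing.Lalgebra_isAlgebra.Build K dsum dsum_scaleAr.

Definition idem (i : 'I_n.+1) : dsum := [ffun j => (j == i)%:R].

Definition ydder (i j : 'I_n.+1) : dder dsum :=
  DDer (commutator_dder (idem i) (idem j)
    : (fun s : dsum => idem i ⊗ (idem j * s) - (s * idem i) ⊗ idem j)
        \in @dder_pred K dsum).

End DirectSum.

(* Main.v *)
Require Import Defs.
From mathcomp Require Import all_boot all_algebra.
From mathcomp Require Import boolp ring.

Set Implicit Arguments.
Unset Strict Implicit.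
Unset Printing Implicit Defensive.

Import GRing.Theory.
Local Open Scope ring_scope.

(** Elements of [S ⊗ S] and [S ⊗ S ⊗ S] are matrices and cubic arrays indexed by
    the idempotents of [S], so the whole question can be read on coordinates.

    The double derivation y^{ij} sends [a] to (a_j - a_i) e_i ⊗ e_j, whence the
    bracket of y^{ij} y^{ji} sends [a ⊗ b] to
    (a_i - a_j)(b_i - b_j)(e_i ⊗ e_j - e_j ⊗ e_i).  With [w] the antisymmetric
    matrix extending alpha from the pairs i < j ([skew]), the bracket of P
    therefore has coordinates w_pq (a_p - a_q)(b_p - b_q)
    ([coef_bracket_ydder]).

    Any linear map with such coordinates and antisymmetric [w] is a derivation
    in its second argument and is antisymmetric; only the Jacobi identity
    constrains [w].  Expanding it, the three pairwise differences indexed by p,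
    q, r sum to zero, both for [a], for [b] and for [c], and the (p, q, r)
    coordinate collapses to the single product
    (w_pq w_qr + w_qr w_rp + w_rp w_pq) (a_p - a_q)(b_q - b_r)(c_r - c_p)
    ([coef3_jacobi]).  It vanishes when two indices coincide, and for distinct
    ones the triple (e_p, e_q, e_r) isolates the cyclic sum
    ([double_poisson_cyc]).  That sum is invariant under all permutations of
    the indices, so it is enough to consider p < q < r, where it is the opposite
    of the quadratic expression in alpha ([cyc_skew_sorted]). *)

(** * Linear maps as plain functions *)

Section Linear.
Variable K : fieldType.
Implicit Types U V : lmodType K.

Lemma linear_sumE U V (f : U -> V) (I : Type) (r : seq I) (Q : pred I)
    (F : I -> U) : linear f ->
  f (\sum_(i <- r | Q i) F i) = \sum_(i <- r | Q i) f (F i).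
Proof.
move=> fl; apply: big_morph; last exact: linear0_ fl.
by move=> u v; rewrite -[u]scale1r fl !scale1r.
Qed.

Lemma linearD_ U V (f : U -> V) u v : linear f -> f (u + v) = f u + f v.
Proof. by move=> fl; rewrite -[u]scale1r fl !scale1r. Qed.

Lemma linearZ_ U V (f : U -> V) c u : linear f -> f (c *: u) = c *: f u.
Proof. by move=> fl; rewrite -[c *: u]addr0 fl (linear0_ fl) addr0. Qed.

Lemma linearN_ U V (f : U -> V) u : linear f -> f (- u) = - f u.
Proof. by move=> fl; rewrite -scaleN1r linearZ_ // scaleN1r. Qed.

Lemma linear_sum_ U V (I : Type) (r : seq I) (F : I -> U -> V) :
  (forall i, linear (F i)) -> linear (fun u => \sum_(i <- r) F i u).
Proof.
move=> Fl c u v; rewrite scaler_sumr -big_split.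
by apply: eq_bigr => i _; rewrite Fl.
Qed.

End Linear.

(** * Coordinates on a tensor product *)

Section TensorCoordinates.
Variables (K : fieldType) (V W : lmodType K).

Lemma mulr_bilin (f : V -> K^o) (g : W -> K^o) :
  linear f -> linear g -> bilin (fun x y => f x * g y : K^o).
Proof.
move=> fl gl; split=> z x u v; first by rewrite fl mulrDl -scalerAl.
by rewrite gl mulrDr -scalerAr.
Qed.

(** The functional f ⊗ g. *)
Definition tcoef (f : V -> K^o) (g : W -> K^o) : tensor V W -> K^o :=
  swd (fun x y => f x * g y : K^o).

Lemma tcoef_linear f g : linear f -> linear g -> linear (tcoef f g).
Proof. by move=> fl gl; apply: swd_linear (mulr_bilin fl gl). Qed.

Lemma tcoefE f g x y :
  linear f -> linear g -> tcoef f g (x ⊗ y) = f x * g y.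
Proof. by move=> fl gl; apply: swdE (mulr_bilin fl gl) x y. Qed.

Section Expansion.
Variables (I J : finType) (f : I -> V -> K^o) (g : J -> W -> K^o).
Variables (v : I -> V) (w : J -> W).
Hypotheses (fl : forall i, linear (f i)) (gl : forall j, linear (g j)).
Hypothesis fv : forall x, x = \sum_i (f i x : K) *: v i.
Hypothesis gw : forall y, y = \sum_j (g j y : K) *: w j.

(** Both sides are linear in [t], so it is enough to expand a pure tensor.  The
    product index set is again a system of coordinates of the kind assumed here,
    which allows a second tensor factor to be added. *)
Lemma tcoef_expand t :
  t = \sum_(p : I * J) (tcoef (f p.1) (g p.2) t : K) *: (v p.1 ⊗ w p.2).
Proof.
apply: (tensor_ext (f := id) (g := fun t => \sum_(p : I * J)
  (tcoef (f p.1) (g p.2) t : K) *: (v p.1 ⊗ w p.2))) => // [|x y].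
  apply: linear_sum_ => p c u u'.
  by rewrite (tcoef_linear (fl _) (gl _)) scalerDl scalerA.
have [tl tr] := tens_bilin V W.
rewrite {1}(fv x) (linear_sumE _ _ _ (tl y)).
under eq_bigr => i _.
  rewrite (linearZ_ _ _ (tl y)) {1}(gw y) (linear_sumE _ _ _ (tr (v i))).
  rewrite scaler_sumr.
  under eq_bigr => j _ do rewrite (linearZ_ _ _ (tr (v i))) scalerA.
  over.
rewrite pair_bigA; apply: eq_bigr => p _.
by rewrite (tcoefE _ _ (fl _) (gl _)).
Qed.

Lemma tcoef_inj s t :
  (forall i j, tcoef (f i) (g j) s = tcoef (f i) (g j) t) -> s = t.
Proof.
move=> st; rewrite (tcoef_expand s) (tcoef_expand t).
by apply: eq_bigr => p _; rewrite st.
Qed.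

End Expansion.

End TensorCoordinates.

(** * The bracket of a degree 2 element *)

Section Bracket.
Variables (K : fieldType) (A : algType K).

(** [mul_bracket] is bilinear in [a] and [b], and evaluating it on any fixed
    representative of [P] preserves this. *)
Lemma bracket_arg_linear (P : DA2 A) : linear (bracket P).
Proof.
apply: (@swd_linear _ _ _ _
  (fun a b : A => swd_over (fun d D => mul_bracket d D a b) P)).
rewrite swd_over.unlock /mqlift; split=> z.
  apply: (@linear_swd_param _ _ _ _ _
    (fun (a : A) d D => mul_bracket d D a z)) => d D.
  exact: (mul_bracket_linear_ab d D).1.
apply: (@linear_swd_param _ _ _ _ _
  (fun (b : A) d D => mul_bracket d D z b)) => d D.
exact: (mul_bracket_linear_ab d D).2.
Qed.

Lemma mul_bracketE (d D : dder A) (a b x y z t x' y' z' t' : A) :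
  d a = x ⊗ y -> D b = z ⊗ t -> d b = x' ⊗ y' -> D a = z' ⊗ t' ->
  mul_bracket d D a b = (z * y) ⊗ (x * t) - (x' * t') ⊗ (z' * y').
Proof.
rewrite /mul_bracket => -> -> -> ->; have [tl tr] := tens_bilin A A.
have B1 u v : bilin (fun p q : A => (p * v) ⊗ (u * q)).
  exact: bilin_tens (linear_mulr v) (linear_mull u).
have B2 u v : bilin (fun p q : A => (u * q) ⊗ (p * v)).
  split=> w; first exact: linear_comp_ (tr _) (linear_mulr v).
  exact: (linear_comp_ (tl (w * v)) (linear_mull u)).
congr (_ - _).
  rewrite (_ : (fun p q => _) = fun p q => (z * q) ⊗ (p * t)).
    exact: swdE (B2 z t) x y.
  by apply/funext=> p; apply/funext=> q; exact: swdE (B1 p q) z t.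
rewrite (_ : (fun p q => _) = fun p q => (p * t') ⊗ (z' * q)).
  exact: swdE (B1 z' t') x' y'.
by apply/funext=> p; apply/funext=> q; exact: swdE (B2 p q) z' t'.
Qed.

End Bracket.

(** * Coordinates on the tensor powers of a sum of copies of the field *)

Section Coordinates.
Variables (K : fieldType) (n : nat).
Local Notation S := (dsum K n).
Local Notation SS := (tensor S S).
Local Notation SSS := (tensor SS S).
Local Notation e := (@idem K n).
Implicit Types (i j k p q r : 'I_n.+1) (a b c : S).

Lemma idemE i j : e i j = (j == i)%:R.
Proof. by rewrite ffunE. Qed.

Lemma dsumD a b i : (a + b) i = a i + b i.
Proof. by rewrite ffunE. Qed.

Lemma dsumM a b i : (a * b) i = a i * b i.
Proof. by rewrite ffunE. Qed.

Lemma dsum1 i : (1 : S) i = 1.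
Proof. by rewrite ffunE. Qed.

Lemma dsumZ (x : K) a i : (x *: a) i = x * a i.
Proof. by rewrite ffunE. Qed.

Lemma dsum_eval_linear i : linear (fun a => a i : K^o).
Proof. by move=> x a b; rewrite dsumD dsumZ. Qed.

Lemma mulr_idem a i : a * e i = a i *: e i.
Proof.
apply/ffunP=> j; rewrite dsumM dsumZ idemE.
by case: eqP => [->|]; rewrite ?mulr0.
Qed.

Lemma mul_idemr a i : e i * a = a i *: e i.
Proof. by rewrite -mulr_idem; apply/ffunP=> j; rewrite !dsumM mulrC. Qed.

Lemma idem_sum a : a = \sum_i a i *: e i.
Proof.
apply/ffunP=> j.
rewrite (linear_sumE _ _ _ (dsum_eval_linear j)) (bigD1 j) //= big1 => [|i ij].
  by rewrite addr0 dsumZ idemE eqxx mulr1.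
by rewrite dsumZ idemE eq_sym (negbTE ij) mulr0.
Qed.

Definition coef i j : SS -> K^o := tcoef (fun a => a i) (fun b => b j).

Definition coef3 i j k : SSS -> K^o := tcoef (coef i j) (fun c => c k).

Lemma coef_linear i j : linear (coef i j).
Proof. exact: tcoef_linear (dsum_eval_linear i) (dsum_eval_linear j). Qed.

Lemma coef3_linear i j k : linear (coef3 i j k).
Proof. exact: tcoef_linear (coef_linear i j) (dsum_eval_linear k). Qed.

Lemma coefE i j a b : coef i j (a ⊗ b) = a i * b j.
Proof. exact: tcoefE a b (dsum_eval_linear i) (dsum_eval_linear j). Qed.

Lemma coef3E i j k (t : SS) c : coef3 i j k (t ⊗ c) = coef i j t * c k.
Proof. exact: tcoefE t c (coef_linear i j) (dsum_eval_linear k). Qed.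

Lemma coefD i j s t : coef i j (s + t) = coef i j s + coef i j t.
Proof. exact: (linearD_ _ _ (coef_linear i j)). Qed.

Lemma coefN i j t : coef i j (- t) = - coef i j t.
Proof. exact: (linearN_ _ (coef_linear i j)). Qed.

Lemma coef3D i j k s t : coef3 i j k (s + t) = coef3 i j k s + coef3 i j k t.
Proof. exact: (linearD_ _ _ (coef3_linear i j k)). Qed.

Lemma coef3_0 i j k : coef3 i j k 0 = 0.
Proof. exact: linear0_ (coef3_linear i j k). Qed.

Lemma coef_expand t :
  t = \sum_(p : 'I_n.+1 * 'I_n.+1) (coef p.1 p.2 t : K) *: (e p.1 ⊗ e p.2).
Proof.
exact: (tcoef_expand dsum_eval_linear dsum_eval_linear idem_sum idem_sum).
Qed.

Lemma coef_inj s t : (forall i j, coef i j s = coef i j t) -> s = t.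
Proof.
exact: (tcoef_inj dsum_eval_linear dsum_eval_linear idem_sum idem_sum).
Qed.

Lemma coef3_inj s t : (forall i j k, coef3 i j k s = coef3 i j k t) -> s = t.
Proof.
move=> st; apply: (tcoef_inj (fun p : 'I_n.+1 * 'I_n.+1 => coef_linear p.1 p.2)
  dsum_eval_linear coef_expand idem_sum) => p k.
exact: st p.1 p.2 k.
Qed.

Lemma coef_outer i j a t b : coef i j (outer a t b) = a i * coef i j t * b j.
Proof.
apply: (tensor_ext (f := fun t => coef i j (outer a t b) : K^o)
  (g := fun t => a i * coef i j t * b j : K^o)) => [||x y].
- exact: linear_comp_ (coef_linear i j) (outer_linear a b).
- by move=> x u v; rewrite coef_linear /= /GRing.scale /=; ring.
- by rewrite outerE !coefE !dsumM !mulrA.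
Qed.

Lemma swap_linear : linear (@swap K S).
Proof. by apply: swd_linear; split=> z; apply tens_bilin. Qed.

Lemma coef_swap i j t : coef i j (swap t) = coef j i t.
Proof.
apply: (tensor_ext (f := fun t => coef i j (swap t) : K^o)
  (g := fun t => coef j i t : K^o)) => [||x y].
- exact: linear_comp_ (coef_linear i j) swap_linear.
- exact: coef_linear.
- rewrite /swap swdE ?coefE 1?mulrC //.
  by split=> z; apply tens_bilin.
Qed.

Let rot_bilin c : bilin (fun a b => c ⊗ a ⊗ b).
Proof.
split=> z; last exact: (tens_bilin _ _).2.
exact: linear_comp_ ((tens_bilin _ _).1 z) ((tens_bilin _ _).2 c).
Qed.

Let rot_bilin2 : bilin (fun (t : SS) c => swd (fun a b => c ⊗ a ⊗ b) t).
Proof.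
split=> z; first exact: swd_linear (rot_bilin z).
apply: linear_swd_param => x y.
exact: linear_comp_ ((tens_bilin _ _).1 y) ((tens_bilin _ _).1 x).
Qed.

Lemma coef3_rot i j k t : coef3 i j k (Defs.rot t) = coef3 j k i t.
Proof.
apply: (tensor_ext (f := fun t => coef3 i j k (Defs.rot t) : K^o)
  (g := fun t => coef3 j k i t : K^o)) => [||t' c].
- exact: linear_comp_ (coef3_linear i j k) (swd_linear rot_bilin2).
- exact: coef3_linear.
rewrite /Defs.rot (swdE rot_bilin2) coef3E.
apply: (tensor_ext (f := fun t => coef3 i j k (swd (fun a b => c ⊗ a ⊗ b) t) : K^o)
  (g := fun t => coef j k t * c i : K^o)) => [||a b].
- exact: linear_comp_ (coef3_linear i j k) (swd_linear (rot_bilin c)).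
- exact: (mulr_bilin (coef_linear j k) (dsum_eval_linear i)).1.
by rewrite (swdE (rot_bilin c)) coef3E !coefE -mulrA mulrC.
Qed.

(** * Brackets given by an antisymmetric matrix of weights *)

Section WeightedBracket.
Variables (w : 'I_n.+1 -> 'I_n.+1 -> K) (br : SS -> SS).
Hypothesis br_linear : linear br.
Hypothesis wN : forall i j, w j i = - w i j.
Hypothesis coef_br : forall i j a b,
  coef i j (br (a ⊗ b)) = w i j * (a i - a j) * (b i - b j).

Let bracketL_bilin a : bilin (fun x y : S => br (a ⊗ x) ⊗ y).
Proof.
have [_ tr] := tens_bilin S S.
split=> z; last exact: (tens_bilin _ _).2.
apply: (linear_comp_ ((tens_bilin SS S).1 z) (g := fun x => br (a ⊗ x))).
exact: (@linear_comp_ K S SS SS br (tens a) br_linear (tr a)).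
Qed.

Lemma coef3_bracketL i j k a t :
  coef3 i j k (bracketL br a t) =
  w i j * (a i - a j) * (coef i k t - coef j k t).
Proof.
apply: (tensor_ext (f := fun t => coef3 i j k (bracketL br a t) : K^o)
  (g := fun t => w i j * (a i - a j) * (coef i k t - coef j k t) : K^o)) => [||x y].
- exact: linear_comp_ (coef3_linear i j k) (swd_linear (bracketL_bilin a)).
- move=> x u v; rewrite !coef_linear /= /GRing.scale /=; ring.
- by rewrite /bracketL (swdE (bracketL_bilin a)) coef3E coef_br !coefE; ring.
Qed.

Definition cyc i j k := w i j * w j k + w j k * w k i + w k i * w i j.

(** After the weights are oriented along the cycle i -> j -> k -> i, each product
    of two weights has two terms; these combine because the differences of [a]
    along the cycle sum to zero, and likewise for [b] and [c]. *)
Lemma coef3_jacobi i j k a b c :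
  coef3 i j k (bracketL br a (br (b ⊗ c)) + Defs.rot (bracketL br b (br (c ⊗ a)))
      + Defs.rot (Defs.rot (bracketL br c (br (a ⊗ b))))) =
  cyc i j k * (a i - a j) * (b j - b k) * (c k - c i).
Proof.
rewrite !coef3D !coef3_rot !coef3_bracketL !coef_br /cyc.
rewrite (wN k i) (wN i j) (wN j k); ring.
Qed.

(** The derivation rule is b_i c_i - b_j c_j = b_i (c_i - c_j) + (b_i - b_j) c_j.
    Conversely the Jacobi identity for three distinct idempotents has the cyclic
    sum as its (i, j, k) coordinate. *)
Lemma double_poisson_cyc : double_poisson br <->
  (forall i j k, i != j -> j != k -> k != i -> cyc i j k = 0).
Proof.
split=> [[_ _ _ jac] i j k ij jk ki | cyc0].
  have := coef3_jacobi i j k (e i) (e j) (e k).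
  rewrite jac coef3_0 !idemE !eqxx.
  rewrite [j == i]eq_sym [k == j]eq_sym [i == k]eq_sym.
  by rewrite (negbTE ij) (negbTE jk) (negbTE ki) !subr0 !mulr1 => <-.
split=> [//|a b c|a b|a b c].
- apply: coef_inj => i j; rewrite coefD !coef_outer !coef_br !dsumM !dsum1; ring.
- by apply: coef_inj => i j; rewrite coefN coef_swap !coef_br (wN i j); ring.
- apply: coef3_inj => i j k; rewrite coef3_jacobi coef3_0.
  have [->|ij] := eqVneq i j; first by rewrite subrr mulr0 !mul0r.
  have [->|jk] := eqVneq j k; first by rewrite subrr mulr0 mul0r.
  have [->|ki] := eqVneq k i; first by rewrite subrr mulr0.
  by rewrite cyc0 // !mul0r.
Qed.

End WeightedBracket.

(** * The bracket of P *)

Lemma ydderE i j a :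
  ydder K i j a = ((a j - a i) *: e i) ⊗ e j.
Proof.
have [tl tr] := tens_bilin S S.
rewrite /= mul_idemr mulr_idem (linearZ_ _ _ (tl _)).
by rewrite (linearZ_ _ _ (tr _)) (linearZ_ _ _ (tl _)) scalerBl.
Qed.

Lemma coef_mul_bracket_ydder i j p q a b :
  coef p q (mul_bracket (ydder K i j) (ydder K j i) a b) =
  (a i - a j) * (b i - b j) *
    (((i == p) && (j == q))%:R - ((j == p) && (i == q))%:R).
Proof.
rewrite (mul_bracketE (ydderE i j a) (ydderE j i b) (ydderE i j b)
  (ydderE j i a)) coefD coefN !coefE !dsumM !dsumZ !idemE.
rewrite ![_ == p]eq_sym ![_ == q]eq_sym.
by do 4! case: eqP => _ /=; ring.
Qed.

Section SumOverEdges.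
Variable alpha : 'I_n.+1 -> 'I_n.+1 -> K.

Definition skew i j : K :=
  if (i < j)%N then alpha i j else if (j < i)%N then - alpha j i else 0.

Lemma skewN i j : skew j i = - skew i j.
Proof. by rewrite /skew; case: ltngtP; rewrite ?opprK ?oppr0. Qed.

Lemma sum_delta (Q : rel 'I_n.+1) (F : 'I_n.+1 -> 'I_n.+1 -> K) p q :
  \sum_i \sum_(j | Q i j) F i j * ((i == p) && (j == q))%:R =
  if Q p q then F p q else 0.
Proof.
rewrite pair_big_dep big_mkcond (bigD1 (p, q)) //= big1 ?addr0 => [|[i j]].
  by rewrite !eqxx mulr1.
by rewrite xpair_eqE => /negbTE ->; rewrite mulr0 if_same.
Qed.

Lemma coef_bracket_ydder p q a b :
  coef p q (bracket (\sum_(i < n.+1) \sum_(j < n.+1 | (i < j)%N)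
      alpha i j *: dder_mul (ydder K i j) (ydder K j i)) (a ⊗ b)) =
  skew p q * (a p - a q) * (b p - b q).
Proof.
pose G := fun R : DA2 S => coef p q (bracket R (a ⊗ b)).
have Gl : linear G := linear_comp_ (coef_linear p q) (bracket_linear (a ⊗ b)).
rewrite -/(G _) (linear_sumE _ _ _ Gl).
pose F i j : K := alpha i j * (a i - a j) * (b i - b j).
transitivity (\sum_(i < n.+1) \sum_(j < n.+1 | (i < j)%N) F i j * ((i == p) && (j == q))%:R
  - \sum_(i < n.+1) \sum_(j < n.+1 | (i < j)%N) F i j * ((i == q) && (j == p))%:R).
  rewrite -sumrB; apply: eq_bigr => i _; rewrite (linear_sumE _ _ _ Gl) -sumrB.
  apply: eq_bigr => j _; rewrite (linearZ_ _ _ Gl) /G bracketE.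
  rewrite coef_mul_bracket_ydder /F [(i == q) && _]andbC.
  rewrite /GRing.scale /=; ring.
rewrite !sum_delta /skew /F; case: ltngtP => _; ring.
Qed.

(** The cyclic sum does not change under rotation, nor under a transposition,
    which changes the sign of both factors of each product; hence every triple of
    distinct indices can be sorted. *)
Lemma cyc_skew_sorted :
  (forall i j k, i != j -> j != k -> k != i -> cyc skew i j k = 0) <->
  (forall i j k, (i < j)%N -> (j < k)%N ->
     alpha i j * alpha i k + alpha i k * alpha j k - alpha i j * alpha j k = 0).
Proof.
have sorted i j k : (i < j)%N -> (j < k)%N -> cyc skew i j k =
    - (alpha i j * alpha i k + alpha i k * alpha j k - alpha i j * alpha j k).
  move=> ij jk; have ik := ltn_trans ij jk.
  rewrite /cyc (skewN i k) /skew ij jk ik; ring.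
have rotate i j k : cyc skew i j k = cyc skew j k i by rewrite /cyc; ring.
have flip i j k : cyc skew i j k = cyc skew j i k.
  by rewrite /cyc (skewN i j) (skewN k j) (skewN i k); ring.
split=> [c0 i j k ij jk | a0 i j k].
  apply/eqP; rewrite -oppr_eq0 -sorted //; apply/eqP/c0.
  - by rewrite neq_ltn ij.
  - by rewrite neq_ltn jk.
  - by rewrite neq_ltn (ltn_trans ij jk) orbT.
have c0 i' j' k' : (i' < j')%N -> (j' < k')%N -> cyc skew i' j' k' = 0.
  by move=> ij jk; rewrite sorted // a0 ?oppr0.
have c1 i' j' k' : (i' < j')%N -> j' != k' -> k' != i' -> cyc skew i' j' k' = 0.
  move=> ij; rewrite neq_ltn => /orP[jk _|kj]; first exact: c0.
  rewrite neq_ltn => /orP[ki|ik]; first by rewrite -rotate c0.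
  by rewrite flip rotate c0.
rewrite neq_ltn => /orP[ij|ji] jk ki; first exact: c1.
by rewrite flip c1 // eq_sym.
Qed.

End SumOverEdges.

End Coordinates.

Theorem proposition4 (C : closedFieldType) (C_char0 : [pchar C] =i pred0)
    (n : nat) (alpha : 'I_n.+1 -> 'I_n.+1 -> C)
    (P : DA2 (dsum C n))
    (defP : P = \sum_(i < n.+1) \sum_(j < n.+1 | (i < j)%N)
                 alpha i j *: dder_mul (ydder C i j) (ydder C j i)) :
  double_poisson (bracket P) <->
  (forall i j k : 'I_n.+1, (i < j)%N -> (j < k)%N ->
     alpha i j * alpha i k + alpha i k * alpha j k - alpha i j * alpha j k = 0).
Proof.
apply: (iff_trans _ (cyc_skew_sorted alpha)).
apply: double_poisson_cyc => [|i j|i j a b]; first exact: bracket_arg_linear.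
  exact: skewN.
by rewrite defP coef_bracket_ydder.
Qed.
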